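(* Let $C$ be a doubly even binary linear code with factor set $\phi$. Then for all $u,v,w\in C$: (1) $\phi(u,v)+\phi(w,u)+\phi(u+v,w)+\phi(v,w+u)\equiv \frac{u\cdot(v+w)}{2}\pmod 2$; (2) $\phi(u+v,u+w)\equiv \frac{\|u\|}{4}+\frac{u\cdot v}{2}+\phi(u,w)+\phi(v+u,w)+\phi(u,v+w)\pmod 2$; (3) $\phi(u+v,u+w)\equiv \frac{\|u\|}{4}+\frac{u\cdot w}{2}+\phi(v,u)+\phi(v,u+w)+\phi(v+w,u)\pmod 2$; (4) $\phi(v,u)+\phi(w,u)+\phi(u+v,w)+\phi(v,w+u)\equiv \frac{u\cdot v+u\cdot(v+w)}{2}\pmod 2$; (5) $\phi(w,u)+\phi(v,w)+\phi(u,v+w)+\phi(v,w+u)\equiv c(u,v,w)+\frac{u\cdot(v+w)}{2}\pmod 2$; (6) $\phi(u+v,u)=\phi(u,u)+\phi(v,u)$ and $\phi(u,u+v)=\phi(u,u)+\phi(u,v)$.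
   Context: Let $F=\mathbb{Z}_2=\{0,1\}$ be the field of two elements and $V=F^n$ a finite-dimensional vector space over $F$. A binary linear code is a subspace $C\le V$. For $u,v,w\in C$, $\|u\|$ is the number of non-zero coordinates of $u$; $u\cdot v$ is the number of coordinates in which both $u$ and $v$ are non-zero; $c(u,v,w)$ is the number of coordinates in which $u$, $v$ and $w$ are all non-zero (all non-negative integers). In expressions such as $u\cdot(v+w)$, the sum $v+w$ is taken in $C$. $C$ is doubly even if for all $u,v\in C$, $u\cdot v$ is even and $\|u\|$ is divisible by $4$. A factor set on such a $C$ is a map $\phi:C\times C\to F$ such that for all $u,v,w\in C$: $\phi(u,u)\equiv \|u\|/4 \pmod 2$; $\phi(u,v)+\phi(v,u)\equiv (u\cdot v)/2 \pmod 2$; $\phi(u,v)+\phi(u+v,w)+\phi(v,w)+\phi(u,v+w)\equiv c(u,v,w)\pmod 2$. (One has $\phi(u,0)=\phi(0,u)=0$.) *)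

(* Defs.v *)
From HB Require Import structures.
From mathcomp Require Import all_boot all_order all_algebra.

Set Implicit Arguments.
Unset Strict Implicit.
Unset Printing Implicit Defensive.

Import GRing.Theory.
Local Open Scope ring_scope.

(* A binary linear code of length n is C : {vspace 'rV['F_2]_n}; its elements
   form the vector space subvs_of C, so that sums of codewords are taken in C. *)
Coercion codeword_val (n : nat) (C : {vspace 'rV['F_2]_n}) (u : subvs_of C) :
  'rV['F_2]_n := vsval u.

Definition weight (n : nat) (u : 'rV['F_2]_n) : nat :=
  #|[set i : 'I_n | u ord0 i != 0]|.

Definition overlap (n : nat) (u v : 'rV['F_2]_n) : nat :=
  #|[set i : 'I_n | (u ord0 i != 0) && (v ord0 i != 0)]|.

Definition overlap3 (n : nat) (u v w : 'rV['F_2]_n) : nat :=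
  #|[set i : 'I_n | [&& u ord0 i != 0, v ord0 i != 0 & w ord0 i != 0]]|.

Definition doubly_even (n : nat) (C : {vspace 'rV['F_2]_n}) : Prop :=
  forall u v : subvs_of C, (2 %| overlap u v)%N /\ (4 %| weight u)%N.

(* A congruence mod 2 between a value of phi and a natural number m is the
   equality with m%:R in 'F_2. On a doubly even code the quotients are exact. *)
Record factor_set (n : nat) (C : {vspace 'rV['F_2]_n})
    (phi : subvs_of C -> subvs_of C -> 'F_2) : Prop := FactorSet {
  factor_set_diag : forall u, phi u u = (weight u %/ 4)%:R;
  factor_set_comm : forall u v, phi u v + phi v u = (overlap u v %/ 2)%:R;
  factor_set_assoc : forall u v w,
    phi u v + phi (u + v) w + phi v w + phi u (v + w) = (overlap3 u v w)%:R
}.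

(* Main.v *)
Require Import Defs.
From mathcomp Require Import all_boot all_order all_algebra.
From mathcomp Require Import ring.
Import GRing.Theory.
Local Open Scope ring_scope.

(** Every identity is an ['F_2]-linear combination of instances of the three
    factor set axioms, chiefly of the cocycle relation.  Since the counts [overlap3] are symmetric,
    cocycle relations on permuted triples have the same right-hand side, so the
    sum of those at [(u, v, w)] and [(v, w, u)] leaves only the commutator
    [phi u (v + w) + phi (v + w) u], which is half of [overlap u (v + w)]:
    this is (1).  Adding the commutator of [u] and [v] gives (4), and (5) is the
    cocycle relation at [(v, w, u)] plus the commutator of [u] and [v + w].

    The identities with a repeated argument rest on [u + u = 0].  A cocycle
    relation on a triple with a repeated entry has right-hand side an overlap
    [u . v], which is even, and this gives (6) ([factor_set_absorbr] and
    [factor_set_absorbl]).  The cocycle relation at [(u + v, u, w)] then gives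
    the expansion
      [phi (u + v) (u + w) = phi u u + phi v u + phi v w + phi u w + c]
    with [c] the triple overlap of [u], [v], [w] ([factor_set_add2]).  Formulas
    (2) and (3) come from it by eliminating [c] with the cocycle relation at
    [(u, v, w)] and at [(v, w, u)] respectively. *)

(** As a rewriting rule for [ring], this makes it decide linear identities in
    characteristic 2. *)
Lemma F2_two0 : 2%:R = 0 :> 'F_2.
Proof. exact/val_inj. Qed.

Lemma F2_addrr (x : 'F_2) : x + x = 0.
Proof. by rewrite -mulr2n -mulr_natr F2_two0 mulr0. Qed.

Lemma F2_addr_eq0 (x y : 'F_2) : x + y = 0 -> x = y.
Proof. by move=> xy0; rewrite -[x]addr0 -(F2_addrr y) addrA xy0 add0r. Qed.

Lemma F2_add_neq0 (x y : 'F_2) : x != 0 -> (x + y != 0) = (y == 0).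
Proof. by case: x y => [[|[|x]] ltx] [[|[|y]] lty]. Qed.

Lemma F2_even (m : nat) : (2 %| m)%N -> m%:R = 0 :> 'F_2.
Proof. by case/dvdnP=> k ->; rewrite natrM F2_two0 mulr0. Qed.

Lemma code_addrr {n : nat} {C : {vspace 'rV['F_2]_n}} (u : subvs_of C) :
  u + u = 0.
Proof. by apply/val_inj/rowP=> i; rewrite /= !mxE F2_addrr. Qed.

Lemma code_addKr {n : nat} {C : {vspace 'rV['F_2]_n}} (u v : subvs_of C) :
  u + v + u = v.
Proof. by rewrite addrAC code_addrr add0r. Qed.

Lemma codeword_valD {n : nat} {C : {vspace 'rV['F_2]_n}} (u v : subvs_of C) :
  codeword_val (u + v) = codeword_val u + codeword_val v.
Proof. exact: raddfD. Qed.

Section Overlaps.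

Context {n : nat}.
Implicit Types u v w : 'rV['F_2]_n.

Lemma weight0 : weight (0 : 'rV['F_2]_n) = 0%N.
Proof. by apply: eq_card0 => i; rewrite !inE mxE eqxx. Qed.

Lemma overlap3_0r u v : overlap3 u v 0 = 0%N.
Proof. by apply: eq_card0 => i; rewrite !inE mxE eqxx !andbF. Qed.

Lemma overlap3_rot u v w : overlap3 v w u = overlap3 u v w.
Proof. by apply: eq_card => i; rewrite !inE andbA andbC. Qed.

Lemma overlap3_id u v : overlap3 u v v = overlap u v.
Proof. by apply: eq_card => i; rewrite !inE andbb. Qed.

(** On the common support of [u] and [w], the word [u + v] is the complement
    of [v]. *)
Lemma overlap3_addl u v w :
  (overlap3 u v w + overlap3 (u + v) u w)%N = overlap u w.
Proof.
rewrite /overlap -(cardsID [set i | v ord0 i != 0]).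
congr (_ + _)%N; apply: eq_card => i; rewrite !inE.
  by rewrite -andbA (andbC (w _ _ != 0)).
rewrite mxE negbK andbA; case: (boolP (u ord0 i == 0)) => [|u_n0] /=.
  by rewrite !andbF.
by rewrite F2_add_neq0 // andbT.
Qed.

End Overlaps.

Section FactorSet.

Context {n : nat} {C : {vspace 'rV['F_2]_n}}.
Context {phi : subvs_of C -> subvs_of C -> 'F_2}.
Hypotheses (HC : doubly_even C) (Hphi : factor_set phi).
Implicit Types u v w : subvs_of C.

Lemma overlap_F2_0 u v : (overlap u v)%:R = 0 :> 'F_2.
Proof. by apply: F2_even; case: (HC u v). Qed.

Lemma factor_set00 : phi 0 0 = 0.
Proof. by rewrite (factor_set_diag Hphi) [codeword_val 0]raddf0 weight0. Qed.

Lemma factor_set0r u : phi u 0 = 0.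
Proof.
have := factor_set_assoc Hphi u 0 0.
rewrite [codeword_val 0]raddf0 overlap3_0r !addr0 factor_set00.
by rewrite addr0 F2_addrr add0r.
Qed.

Lemma factor_set0l u : phi 0 u = 0.
Proof.
have := factor_set_assoc Hphi 0 0 u.
rewrite [codeword_val 0]raddf0 overlap3_rot overlap3_0r.
by rewrite !add0r factor_set00 add0r F2_addrr add0r.
Qed.

(** The cocycle relation at [(v, u, u)], where [u + u = 0] and the right-hand
    side is the even number [v . u]. *)
Lemma factor_set_absorbr u v : phi (u + v) u = phi u u + phi v u.
Proof.
have := factor_set_assoc Hphi v u u.
rewrite code_addrr factor_set0r addr0 overlap3_id overlap_F2_0 (addrC v u).
move=> assoc_vuu; apply: F2_addr_eq0; rewrite -assoc_vuu; ring.
Qed.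

Lemma factor_set_absorbl u v : phi u (u + v) = phi u u + phi u v.
Proof.
have := factor_set_assoc Hphi u u v.
rewrite code_addrr factor_set0l addr0 overlap3_rot.
rewrite overlap3_id overlap_F2_0.
by move=> assoc_uuv; apply/esym/F2_addr_eq0.
Qed.

Lemma factor_set_add2 u v w :
  phi (u + v) (u + w)
    = phi u u + phi v u + phi v w + phi u w + (overlap3 u v w)%:R.
Proof.
have c_add : (overlap3 (u + v)%R u w)%:R = (overlap3 u v w)%:R :> 'F_2.
  apply/esym/F2_addr_eq0.
  by rewrite -natrD overlap3_addl overlap_F2_0.
have := factor_set_assoc Hphi (u + v) u w.
rewrite code_addKr codeword_valD c_add factor_set_absorbr => <-.
apply: F2_addr_eq0.
ring: F2_two0.
Qed.

End FactorSet.

Theorem corollary6p3 (n : nat) (C : {vspace 'rV['F_2]_n})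
    (phi : subvs_of C -> subvs_of C -> 'F_2)
    (HC : doubly_even C) (Hphi : factor_set phi) (u v w : subvs_of C) :
  (phi u v + phi w u + phi (u + v) w + phi v (w + u)
     = (overlap u (v + w)%R %/ 2)%:R) /\
  (phi (u + v) (u + w)
     = (weight u %/ 4)%:R + (overlap u v %/ 2)%:R
       + phi u w + phi (v + u) w + phi u (v + w)) /\
  (phi (u + v) (u + w)
     = (weight u %/ 4)%:R + (overlap u w %/ 2)%:R
       + phi v u + phi v (u + w) + phi (v + w) u) /\
  (phi v u + phi w u + phi (u + v) w + phi v (w + u)
     = ((overlap u v + overlap u (v + w)%R) %/ 2)%:R) /\
  (phi w u + phi v w + phi u (v + w) + phi v (w + u)
     = (overlap3 u v w + overlap u (v + w)%R %/ 2)%:R) /\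
  (phi (u + v) u = phi u u + phi v u /\
   phi u (u + v) = phi u u + phi u v).
Proof.
have [even_uv _] := HC u v.
rewrite divnDl // !natrD -(factor_set_diag Hphi).
rewrite -!(factor_set_comm Hphi) (factor_set_add2 HC Hphi).
rewrite (factor_set_absorbr HC Hphi) (factor_set_absorbl HC Hphi).
rewrite (addrC v u) (addrC w u).
have assoc_uvw := factor_set_assoc Hphi u v w.
have := factor_set_assoc Hphi v w u; rewrite overlap3_rot (addrC w u).
move=> assoc_vwu.
have sum_assoc : phi u v + phi w u + phi (u + v) w + phi v (u + w)
               = phi u (v + w) + phi (v + w) u.
  apply: F2_addr_eq0; rewrite -(F2_addrr (overlap3 u v w)%:R).
  rewrite -{1}assoc_uvw -assoc_vwu; ring: F2_two0.
split; first exact: sum_assoc.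
split; first by rewrite -assoc_uvw; ring: F2_two0.
split; first by rewrite -assoc_vwu; ring: F2_two0.
split; first by rewrite -sum_assoc; ring: F2_two0.
by split; first by rewrite -assoc_vwu; ring: F2_two0.
Qed.
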